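(* Suppose that for every $\alpha\in\mathbb{R}$ the set $\{x\in C: f(x)\le\alpha\}$ is compact (possibly empty), and let $\underline f\in\mathbb{R}$ be such that $f(x)\ge\underline f$ for all $x\in C$. Consider the iterates generated by the homotopy algorithm with near-feasible initialization (described in the context), with $\lambda^\nu$ being updated as $\lambda^\nu=\rho\lambda^{\nu-1}$ with $\rho\in(0,1)$. Then the algorithm terminates in at most $$\bar\nu<1+\log_{\frac1\rho}\left(\frac{4\lambda^0(f(x^0)-\underline f)}{\epsilon^2}\right)$$ iterations. Furthermore, the last iterate $x^{\bar\nu}$ satisfies the approximate C-stationarity condition $$\operatorname{dist}\Big(-\nabla f(x^{\bar\nu})-\sum_{i=1}^pJF_i(x^{\bar\nu})^\top y_i^{\bar\nu},\ N_C(x^{\bar\nu})\Big)\le\epsilon,\qquad \big\|\min\{G(x^{\bar\nu}),H(x^{\bar\nu})\}\big\|\le\epsilon,\qquad y_i^{\bar\nu}\in N_D^{\rm C}(z_i^{\bar\nu})$$ for all $i\in\{1,\dots,p\}$, where the minimum is componentwise, $z_i^{\bar\nu}=\Pi_D^{{\rm C},\beta}(F_i(x^{\bar\nu}))$ and $y_i^{\bar\nu}=\frac1{\lambda^{\bar\nu}}R_\beta(F_i(x^{\bar\nu}))$.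
   Context: Setting: $f:\mathbb{R}^n\to\mathbb{R}$ and $G,H:\mathbb{R}^n\to\mathbb{R}^p$ are smooth, $C\subseteq\mathbb{R}^n$ is nonempty, closed and convex; the problem is to minimize $f(x)$ over $x\in C$ subject to $G(x)\ge0$, $H(x)\ge0$, $\langle G(x),H(x)\rangle=0$, and its solution set is assumed nonempty. $F_i=(G_i,H_i):\mathbb{R}^n\to\mathbb{R}^2$ with Jacobian $JF_i(x)\in\mathbb{R}^{2\times n}$ (rows $\nabla G_i(x)^\top,\nabla H_i(x)^\top$). $D=\{z\in\mathbb{R}^2:z_1,z_2\ge0,\ z_1z_2=0\}$. $N_C$ is the normal cone of the convex set $C$. For $\beta\in(0,1)$ let $T_\beta=\{z\in\mathbb{R}^2:(1-\beta)z_1\le z_2\le\frac{1}{1-\beta}z_1\}$ and $$r_\beta(z)=\begin{cases}\frac{1}{2(1-\beta)}\|z\|^2&\text{if }z_1\le0,z_2\le0\\ \frac{(z_1+z_2)^2}{2\beta(2-\beta)}-\frac{\|z\|^2}{2\beta}&\text{if }z\in T_\beta\\ \frac{1}{2(1-\beta)}\min\{z_1,z_2\}^2&\text{otherwise,}\end{cases}$$ which is continuously differentiable; $R_\beta=\nabla r_\beta$; $s_{\lambda,\beta}(x)=f(x)+\frac1\lambda\sum_{i=1}^pr_\beta(F_i(x))$. Cone at $z\in D$: $N_D^{\rm C}(z)=\{0\}\times\mathbb{R}$ if $z_1>0$; $\mathbb{R}\times\{0\}$ if $z_2>0$; $N_D^{\rm C}((0,0))=\{y:y_1\le0,y_2\le0\}\cup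 D\cup\mathbb{R}_+^2$. The operator $\Pi_D^{{\rm C},\beta}$: $\Pi_D^{{\rm C},\beta}(z)=(0,0)$ if $z\in\operatorname{int}T_\beta$, and otherwise $\Pi_D^{{\rm C},\beta}(z)=\Pi_D(z)$, the (then unique) Euclidean projection of $z$ onto $D$. Algorithm (near-feasible initialization): given $\epsilon>0$, $\lambda^0>0$, $\beta\in(0,1)$ and $x^0\in C$ with $\sum_{i=1}^pr_\beta(F_i(x^0))\le\epsilon^2/4$. At iterations $\nu=1,2,\dots$, with parameter $\lambda^\nu$, an inner solver started from a point $x^{\nu,0}\in\{x^{\nu-1},x^0\}$ having the smaller value of $s_{\lambda^\nu,\beta}$ returns an approximate solution $x^\nu\in C$ of the problem of minimizing $s_{\lambda^\nu,\beta}$ over $C$, such that $s_{\lambda^\nu,\beta}(x^\nu)\le\min\{s_{\lambda^\nu,\beta}(x^{\nu-1}),s_{\lambda^\nu,\beta}(x^0)\}$ and $\operatorname{dist}(-\nabla s_{\lambda^\nu,\beta}(x^\nu),N_C(x^\nu))\le\epsilon$. The algorithm stops at the first iteration $\nu\ge1$ for which $\sum_{i=1}^pr_\beta(F_i(x^\nu))\le\epsilon^2/2$; this index is denoted $\bar\nu$.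
   Formalization: With a = 4λ⁰(f(x⁰)−f̲)/ε², the bound ν̄ < 1 + log_{1/ρ}(a) is asserted only for a > 1; for a ≤ 1, where it fails or is undefined because ν̄ ≥ 1, the theorem asserts ν̄ = 1 instead. *)

(* Defs.v *)
From HB Require Import structures.
From mathcomp Require Import all_boot all_order all_algebra.
From mathcomp Require Import all_classical all_reals all_analysis.

Set Implicit Arguments.
Unset Strict Implicit.
Unset Printing Implicit Defensive.

Import Order.TTheory GRing.Theory Num.Theory.
Import numFieldNormedType.Exports.

Local Open Scope classical_set_scope.
Local Open Scope ring_scope.

(* Vectors of R^n are row vectors 'rV[R]_n.  The library norm `|v| on 'rV[R]_n
   is the max norm, hence the explicit Euclidean norm below; the two norms
   induce the same topology, so that the library's closed, compact, interior,
   continuous and differentiable are the usual ones on R^n. *)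

Section Euclidean.
Context {R : realType}.

Definition dot n (u v : 'rV[R]_n) : R := \sum_(j < n) u 0 j * v 0 j.

Definition norm2 n (v : 'rV[R]_n) : R := Num.sqrt (dot v v).

(* Extended-real valued: +oo when S is empty. *)
Definition dist n (v : 'rV[R]_n) (S : set 'rV[R]_n) : \bar R :=
  ereal_inf [set (norm2 (v - w))%:E | w in S].

Definition grad n (f : 'rV[R]_n -> R) (x : 'rV[R]_n) : 'rV[R]_n :=
  \row_j 'D_(delta_mx 0 j) f x.

Definition smooth n (f : 'rV[R]_n -> R) : Prop :=
  (forall x, differentiable f x) /\ continuous (grad f).

Definition normal_cone n (C : set 'rV[R]_n) (x : 'rV[R]_n) : set 'rV[R]_n :=
  [set v | C x /\ forall y, C y -> dot v (y - x) <= 0].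

Definition is_projection n (S : set 'rV[R]_n) (z w : 'rV[R]_n) : Prop :=
  S w /\ forall w', S w' -> norm2 (z - w) <= norm2 (z - w').

End Euclidean.

Section Plane.
Context {R : realType}.

Definition crd1 (z : 'rV[R]_2) : R := z 0 ord0.
Definition crd2 (z : 'rV[R]_2) : R := z 0 ord_max.

Definition Dset : set 'rV[R]_2 :=
  [set z | [/\ 0 <= crd1 z, 0 <= crd2 z & crd1 z * crd2 z = 0]].

Definition Tset (beta : R) : set 'rV[R]_2 :=
  [set z | (1 - beta) * crd1 z <= crd2 z <= (1 - beta)^-1 * crd1 z].

(* The first two cases overlap only at the origin, where both vanish. *)
Definition rbeta (beta : R) (z : 'rV[R]_2) : R :=
  if (crd1 z <= 0) && (crd2 z <= 0) then
    (2 * (1 - beta))^-1 * norm2 z ^+ 2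
  else if (1 - beta) * crd1 z <= crd2 z <= (1 - beta)^-1 * crd1 z then
    (crd1 z + crd2 z) ^+ 2 / (2 * beta * (2 - beta))
      - norm2 z ^+ 2 / (2 * beta)
  else (2 * (1 - beta))^-1 * Num.min (crd1 z) (crd2 z) ^+ 2.

Definition Rbeta (beta : R) : 'rV[R]_2 -> 'rV[R]_2 := grad (rbeta beta).

(* Empty outside Dset. *)
Definition NDC (z : 'rV[R]_2) : set 'rV[R]_2 :=
  [set y | Dset z /\
     [\/ 0 < crd1 z /\ crd1 y = 0,
         0 < crd2 z /\ crd2 y = 0
       | z = 0 /\ [\/ crd1 y <= 0 /\ crd2 y <= 0,
                      Dset y
                    | 0 <= crd1 y /\ 0 <= crd2 y]]].

(* xget picks a Euclidean projection onto Dset; outside the interior of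
   Tset beta there is exactly one, so the default value 0 is never used. *)
Definition PiDC (beta : R) (z : 'rV[R]_2) : 'rV[R]_2 :=
  if `[< interior (Tset beta) z >] then 0 else xget 0 [set w | is_projection Dset z w].

End Plane.

Section MPCC.
Context {R : realType}.
Variables (n p : nat) (f : 'rV[R]_n -> R) (G H : 'rV[R]_n -> 'rV[R]_p).
Variable C : set 'rV[R]_n.

Definition feasible : set 'rV[R]_n :=
  [set x | [/\ C x, forall i, 0 <= G x 0 i, forall i, 0 <= H x 0 i
             & dot (G x) (H x) = 0]].

Definition solutions : set 'rV[R]_n :=
  [set x | feasible x /\ forall y, feasible y -> f x <= f y].

Definition Fpair (i : 'I_p) (x : 'rV[R]_n) : 'rV[R]_2 :=
  \row_(k < 2) (if k == ord0 then G x 0 i else H x 0 i).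

(* With row vectors, the transposed product JF_i(x)^T y is y *m JF i x. *)
Definition JF (i : 'I_p) (x : 'rV[R]_n) : 'M[R]_(2, n) :=
  col_mx (grad (fun u => G u 0 i) x) (grad (fun u => H u 0 i) x).

Definition penalty (beta : R) (x : 'rV[R]_n) : R :=
  \sum_(i < p) rbeta beta (Fpair i x).

Definition slb (lambda beta : R) (x : 'rV[R]_n) : R :=
  f x + lambda^-1 * penalty beta x.

Definition min_vec (u v : 'rV[R]_p) : 'rV[R]_p :=
  \row_i Num.min (u 0 i) (v 0 i).

Variables eps beta rho : R.

Definition stop_test (x : 'rV[R]_n) : Prop := penalty beta x <= eps ^+ 2 / 2.

(* Start of the inner solver (xs), and its output (xnew). *)
Definition inner_step (lambda : R) (xprev x0 xs xnew : 'rV[R]_n) : Prop :=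
  let s := slb lambda beta in
  [/\ (xs = xprev \/ xs = x0) /\ s xs = Num.min (s xprev) (s x0),
      C xnew,
      s xnew <= Num.min (s xprev) (s x0)
    & (dist (- grad s xnew) (normal_cone C xnew) <= eps%:E)%E].

(* x nu, lam nu are the iterate and parameter of index nu and xs nu is the
   point x^{nu,0} from which the inner solver is started.  Iteration nu.+1 is
   carried out only if none of the iterations 1, ..., nu met the stopping
   test; the values of x and xs after the stopping index are arbitrary. *)
Definition homotopy_run (lam : nat -> R) (x xs : nat -> 'rV[R]_n) : Prop :=
  [/\ 0 < lam 0%N,
      forall nu, lam nu.+1 = rho * lam nu,
      C (x 0%N) /\ penalty beta (x 0%N) <= eps ^+ 2 / 4
    & forall nu, (forall mu, (1 <= mu <= nu)%N -> ~ stop_test (x mu)) ->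
        inner_step (lam nu.+1) (x nu) (x 0%N) (xs nu.+1) (x nu.+1)].

Definition stops_at (x : nat -> 'rV[R]_n) (nubar : nat) : Prop :=
  [/\ (1 <= nubar)%N, stop_test (x nubar)
    & forall mu, (1 <= mu < nubar)%N -> ~ stop_test (x mu)].

End MPCC.

(* Main.v *)
From HB Require Import structures.
Require Import Defs.
From mathcomp Require Import all_boot all_order all_algebra.
From mathcomp Require Import all_classical all_reals all_analysis.
From mathcomp Require Import ring lra.
Import Order.TTheory GRing.Theory Num.Theory.
Import numFieldNormedType.Exports.
Local Open Scope classical_set_scope.
Local Open Scope ring_scope.

(* Every iterate satisfies [s (x nu) <= s (x 0)], where the penalty of [x 0] is
   at most [eps^2 / 4].  If the stopping test fails at [nu], the penalty of
   [x nu] exceeds [eps^2 / 2], hence [eps^2 / 4 < lam nu * (f (x 0) - fmin)];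
   since [lam nu = rho^nu * lam 0], this bounds [nu].  At the last iterate, the
   chain rule turns the stationarity of the merit function into the first
   condition, the second follows from [min(z1, z2)^2 / 2 <= rbeta z], and the
   third is read off the sign pattern of the gradient of [rbeta].
   Differentiability of [rbeta] across the borders of its pieces holds because,
   near every point except the origin, [rbeta] is a diagonal quadratic form
   plus a multiple of the squared positive part of a linear form. *)

(** * Gradients from quadratic remainder bounds *)

Section Differentiability.
Context {R : realType}.

Lemma dot_is_linear n (g : 'rV[R]_n) : linear (dot g).
Proof.
move=> k u v; rewrite /dot scaler_sumr -big_split /=.
apply: eq_bigr => j _.
by rewrite !mxE mulrDr mulrCA.
Qed.

HB.instance Definition _ n (g : 'rV[R]_n) :=
  GRing.isLinear.Build R 'rV[R]_n R *:%R (dot g) (dot_is_linear n g).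

Lemma normr_coord n (h : 'rV[R]_n) j : `|h 0 j| <= `|h|.
Proof.
rewrite [leRHS]/Num.norm/= mx_normrE.
by apply: (le_bigmax _ (fun ij : 'I_1 * 'I_n => `|h ij.1 ij.2|) (0, j)).
Qed.

Lemma normr_dot_le n (g h : 'rV[R]_n) : `|dot g h| <= (\sum_j `|g 0 j|) * `|h|.
Proof.
apply: le_trans (ler_norm_sum _ _ _) _; rewrite mulr_suml ler_sum// => j _.
by rewrite normrM ler_wpM2l// normr_coord.
Qed.

Lemma dot_continuous n (g : 'rV[R]_n) : continuous (dot g).
Proof.
apply: bounded_linear_continuous.
apply/linear_boundedP.
apply: filterS (nbhs_pinfty_ge (num_real (\sum_j `|g 0 j|))) => r gr h.
by apply: le_trans (normr_dot_le _ _ _) _; rewrite ler_wpM2r.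
Qed.

(** A remainder of order [|w - z|^2] is little-o of [|w - z|], and the differential is unique, so it
    is [dot g]. *)
Lemma is_diff_quadratic n (f : 'rV[R]_n -> R) (z g : 'rV[R]_n) (M : R) :
  (\forall w \near z, `|f w - f z - dot g (w - z)| <= M * `|w - z| ^+ 2) ->
  is_diff z f (dot g).
Proof.
move=> fM.
have f0 : \forall h \near (0 : 'rV[R]_n),
    `|f (h + z) - f z - dot g h| <= M * `|h| ^+ 2.
  move: fM; rewrite (near_shift 0 z) /= subr0.
  by apply: filterS => h /=; rewrite addrK.
have fE : f \o shift z = cst (f z) + dot g +o_ (0 : 'rV[R]_n) id.
  apply/eqaddoP => _/posnumP[e] /=.
  (* [M] may be zero or negative; a positive majorant is needed to divide [e] by it. *)
  have [M0 M1] : M <= `|M| + 1 /\ 0 < `|M| + 1.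
    by split; [rewrite (le_trans (ler_norm _))// lerDl|rewrite ltr_wpDl].
  near=> h; rewrite /= -![(_ - _ : _ -> _) _]/(_ - _) -![(_ + _ : _ -> _) _]/(_ + _).
  have : `|f (h + z) - f z - dot g h| <= M * `|h| ^+ 2.
    by near: h.
  rewrite opprD addrA => /le_trans; apply.
  rewrite expr2 mulrA ler_wpM2r//.
  apply: (@le_trans _ _ ((`|M| + 1) * `|h|)); first by rewrite ler_wpM2r.
  rewrite mulrC -ler_pdivlMr; last exact: M1.
  near: h; apply: (cvgr0_norm_le id) => //; exact: divr_gt0.
have dE : 'd f z = dot g :> (_ -> _).
  by apply: diff_unique => //; exact: dot_continuous.
split => //; apply/diff_locallyP; rewrite dE; split => //.
exact: dot_continuous.
Unshelve. all: by end_near. Qed.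

Lemma is_diff_grad n (f : 'rV[R]_n -> R) (z g : 'rV[R]_n) :
  is_diff z f (dot g) -> grad f z = g.
Proof.
move=> [df dE]; apply/rowP => j.
rewrite mxE deriveE// dE /dot (bigD1 j)//= big1 ?addr0.
  by rewrite mxE !eqxx mulr1.
by move=> i ij; rewrite mxE (negbTE ij) andbF mulr0.
Qed.

Lemma diff_grad n (f : 'rV[R]_n -> R) z : differentiable f z ->
  'd f z = dot (grad f z) :> ('rV[R]_n -> R).
Proof.
move=> df; apply/funext => h; rewrite [in LHS](row_sum_delta h) linear_sum.
by apply: eq_bigr => j _; rewrite linearZ /= mxE deriveE// mulrC.
Qed.

(** The squared positive part is convex with a 2-Lipschitz derivative, so its first-order remainder
    lies between 0 and [d^2], also across the kink of [max]. *)
Lemma max0_sqr_taylor (t d : R) :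
  0 <= Num.max (t + d) 0 ^+ 2 - Num.max t 0 ^+ 2 - 2 * Num.max t 0 * d <= d ^+ 2.
Proof.
by have [t0|t0] := leP t 0; have [td0|td0] := leP (t + d) 0; apply/andP; split; nra.
Qed.

Lemma is_diff_sqr_max0 n (r : 'rV[R]_n -> R) (a z l : 'rV[R]_n) (c : R) :
  (\forall w \near z,
     r w = \sum_j a 0 j * w 0 j ^+ 2 + c * Num.max (dot l w) 0 ^+ 2) ->
  is_diff z r (dot (\row_j (2 * a 0 j * z 0 j + 2 * c * Num.max (dot l z) 0 * l 0 j))).
Proof.
move=> rE; have rz := nbhs_singleton rE.
(* In the max norm, the sum of the [|a_j|] bounds the quadratic form of the increment, and the sum
   of the [|l_j|] bounds the linear form [l], which enters squared. *)
apply: (@is_diff_quadratic _ _ _ _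
  (\sum_j `|a 0 j| + `|c| * (\sum_j `|l 0 j|) ^+ 2)).
apply: filterS rE => w ->; rewrite rz.
set h := w - z.
have dw : dot l w = dot l z + dot l h by rewrite -linearD /h /= addrC subrK.
(* The remainder is exactly the quadratic form taken at the increment [h], plus [c] times the
   remainder of [max0_sqr_taylor]. *)
have -> : \sum_j a 0 j * w 0 j ^+ 2 + c * Num.max (dot l w) 0 ^+ 2 -
   (\sum_j a 0 j * z 0 j ^+ 2 + c * Num.max (dot l z) 0 ^+ 2) -
   dot (\row_j (2 * a 0 j * z 0 j + 2 * c * Num.max (dot l z) 0 * l 0 j)) h =
   \sum_j a 0 j * h 0 j ^+ 2 + c * (Num.max (dot l z + dot l h) 0 ^+ 2
      - Num.max (dot l z) 0 ^+ 2 - 2 * Num.max (dot l z) 0 * dot l h).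
  rewrite dw; set m := Num.max (_ + _) 0; set k := Num.max _ 0.
  have -> : dot (\row_j (2 * a 0 j * z 0 j + 2 * c * k * l 0 j)) h =
    \sum_j 2 * a 0 j * z 0 j * h 0 j + 2 * c * k * dot l h.
    rewrite /dot mulr_sumr -big_split/=; apply: eq_bigr => j _.
    by rewrite !mxE mulrDl !mulrA.
  have -> : \sum_j a 0 j * w 0 j ^+ 2 = \sum_j a 0 j * z 0 j ^+ 2 +
    \sum_j 2 * a 0 j * z 0 j * h 0 j + \sum_j a 0 j * h 0 j ^+ 2.
    by rewrite -!big_split/=; apply: eq_bigr => j _; rewrite /h !mxE; ring.
  ring.
rewrite [leRHS]mulrDl; apply: le_trans (ler_normD _ _) _; apply: lerD.
  apply: le_trans (ler_norm_sum _ _ _) _; rewrite mulr_suml ler_sum// => j _.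
  by rewrite normrM ler_wpM2l// normrX lerXn2r ?nnegrE ?normr_coord.
rewrite normrM -[leRHS]mulrA ler_wpM2l//.
have /andP[t0 t1] := max0_sqr_taylor (dot l z) (dot l h).
rewrite ger0_norm// (le_trans t1)// -exprMn -[leLHS]real_normK ?num_real//.
by rewrite lerXn2r ?nnegrE ?normr_dot_le// mulr_ge0// sumr_ge0.
Qed.

End Differentiability.

(** * Coordinates of the plane and the pieces of [rbeta] *)

Section Plane.
Context {R : realType}.
Implicit Types (z w : 'rV[R]_2) (r : 'rV[R]_2 -> R).

Definition vec2 (a b : R) : 'rV[R]_2 := \row_k (if k == ord0 then a else b).

Lemma crd1_vec2 a b : crd1 (vec2 a b) = a. Proof. by rewrite /crd1 mxE. Qed.

Lemma crd2_vec2 a b : crd2 (vec2 a b) = b. Proof. by rewrite /crd2 mxE. Qed.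

Lemma sum_ord2 (F : 'I_2 -> R) : \sum_j F j = F ord0 + F ord_max.
Proof.
rewrite big_ord_recl big_ord1; congr (_ + F _); exact: val_inj.
Qed.

Lemma crd_inj z w : crd1 z = crd1 w -> crd2 z = crd2 w -> z = w.
Proof.
move=> e1 e2; apply/rowP => j; case: (eqVneq j ord0) => [->//|j0].
suff -> : j = ord_max by [].
by apply: val_inj; case: j j0 => -[|[|]].
Qed.

Lemma dot2E z w : dot z w = crd1 z * crd1 w + crd2 z * crd2 w.
Proof. exact: sum_ord2. Qed.

Lemma norm2_sqr n (v : 'rV[R]_n) : norm2 v ^+ 2 = \sum_j v 0 j ^+ 2.
Proof. by rewrite sqr_sqrtr// sumr_ge0// => j _; rewrite -expr2 sqr_ge0. Qed.

Lemma norm2_sqr2 z : norm2 z ^+ 2 = crd1 z ^+ 2 + crd2 z ^+ 2.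
Proof. by rewrite norm2_sqr sum_ord2. Qed.

Lemma near_dot_gt0 (l z : 'rV[R]_2) : 0 < dot l z -> \forall w \near z, 0 < dot l w.
Proof. by move=> lz; exact: (cvgr_gt _ (@dot_continuous _ _ l z)). Qed.

Lemma near_crd_gt0 (a b : R) z : 0 < a * crd1 z + b * crd2 z ->
  \forall w \near z, 0 < a * crd1 w + b * crd2 w.
Proof.
have E w : dot (vec2 a b) w = a * crd1 w + b * crd2 w.
  by rewrite dot2E crd1_vec2 crd2_vec2.
by rewrite -E => /near_dot_gt0; apply: filterS => w; rewrite E.
Qed.

Definition has_grad r z (g1 g2 : R) : Prop :=
  [/\ differentiable r z, crd1 (grad r z) = g1 & crd2 (grad r z) = g2].

Lemma has_grad_sqr_max0 r z (a1 a2 c l1 l2 : R) :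
  (\forall w \near z, r w = a1 * crd1 w ^+ 2 + a2 * crd2 w ^+ 2
                            + c * Num.max (l1 * crd1 w + l2 * crd2 w) 0 ^+ 2) ->
  let m := Num.max (l1 * crd1 z + l2 * crd2 z) 0 in
  has_grad r z (2 * a1 * crd1 z + 2 * c * m * l1)
               (2 * a2 * crd2 z + 2 * c * m * l2).
Proof.
move=> rE m.
have E w : dot (vec2 l1 l2) w = l1 * crd1 w + l2 * crd2 w.
  by rewrite dot2E crd1_vec2 crd2_vec2.
have : \forall w \near z, r w = \sum_j vec2 a1 a2 0 j * w 0 j ^+ 2
    + c * Num.max (dot (vec2 l1 l2) w) 0 ^+ 2.
  by apply: filterS rE => w ->; rewrite E sum_ord2 !mxE.
move=> /is_diff_sqr_max0; rewrite E -/m => d.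
have gE := is_diff_grad _ _ _ _ d.
by split; [case: d|rewrite gE /crd1 !mxE|rewrite gE /crd2 !mxE].
Qed.

Section Rbeta.
Variable b : R.
Hypothesis b01 : 0 < b < 1.

(* [K] makes the middle piece of [rbeta] equal to [A * z2^2 - K * u^2] with
   [u = z2 - (1 - b) * z1], and symmetrically with the coordinates swapped. *)
Let A : R := (2 * (1 - b))^-1.
Let K : R := (2 * b * (2 - b) * (1 - b))^-1.

Let b_gt0 : 0 < b. Proof. by case/andP: b01. Qed.
Let b1_gt0 : 0 < 1 - b. Proof. by rewrite subr_gt0; case/andP: b01. Qed.
Let b2_gt0 : 0 < 2 - b. Proof. by move: b1_gt0; lra. Qed.
Let A_gt0 : 0 < A. Proof. by rewrite invr_gt0 mulr_gt0. Qed.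
Let K_gt0 : 0 < K. Proof. by rewrite invr_gt0 !mulr_gt0. Qed.

(** Clearing the inverse makes the two inequalities mirror images under the swap of coordinates and
    keeps later arithmetic free of division. *)
Lemma TsetE z : Tset b z =
  ((1 - b) * crd1 z <= crd2 z /\ (1 - b) * crd2 z <= crd1 z) :> Prop.
Proof.
by apply/propext; rewrite /Tset /= ler_pdivlMl//; split => [/andP//|[-> ->]].
Qed.

Lemma rbeta_nonpos z : crd1 z <= 0 -> crd2 z <= 0 ->
  rbeta b z = A * (crd1 z ^+ 2 + crd2 z ^+ 2).
Proof. by rewrite /rbeta -norm2_sqr2 => -> ->. Qed.

Lemma rbeta_T z : 0 < crd1 z -> Tset b z ->
  rbeta b z = (2 * b * (2 - b))^-1 *
    (2 * crd1 z * crd2 z - (1 - b) * (crd1 z ^+ 2 + crd2 z ^+ 2)).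
Proof.
move=> z0 zT; rewrite /rbeta leNgt z0 /= zT norm2_sqr2.
by field; rewrite !gt_eqF.
Qed.

Lemma rbeta_below_T z : 0 < crd1 z -> crd2 z < (1 - b) * crd1 z ->
  rbeta b z = A * crd2 z ^+ 2.
Proof.
move=> z0 zT; rewrite /rbeta leNgt z0 /= leNgt zT /= min_r//.
by move: zT z0 b_gt0; nra.
Qed.

Lemma rbeta_above_T z : 0 < crd2 z -> crd1 z < (1 - b) * crd2 z ->
  rbeta b z = A * crd1 z ^+ 2.
Proof.
move=> z0 zT; rewrite /rbeta andbC leNgt z0 /= ler_pdivlMl// andbC leNgt zT /=.
rewrite min_l//.
by move: zT z0 b_gt0; nra.
Qed.

Lemma T_gt0 z : Tset b z -> ~ (crd1 z <= 0 /\ crd2 z <= 0) ->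
  0 < crd1 z /\ 0 < crd2 z.
Proof.
rewrite TsetE => -[h1 h2] h.
have := b_gt0; have := b1_gt0 => c0 b0.
have [z1|z1] := leP (crd1 z) 0; first by case: h; split=> //; nra.
by split=> //; nra.
Qed.

(** The last piece of [rbeta] is split in two so that the [min] is resolved: below the wedge the
    second coordinate is the smaller one, above it the first. *)
Variant rbeta_spec z : R -> Prop :=
| RbetaNonpos of crd1 z <= 0 & crd2 z <= 0 :
    rbeta_spec z (A * (crd1 z ^+ 2 + crd2 z ^+ 2))
| RbetaT of 0 < crd1 z & 0 < crd2 z & (1 - b) * crd1 z <= crd2 z
    & (1 - b) * crd2 z <= crd1 z :
    rbeta_spec z ((2 * b * (2 - b))^-1 *
      (2 * crd1 z * crd2 z - (1 - b) * (crd1 z ^+ 2 + crd2 z ^+ 2)))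
| RbetaBelow of 0 < crd1 z & crd2 z < (1 - b) * crd1 z :
    rbeta_spec z (A * crd2 z ^+ 2)
| RbetaAbove of 0 < crd2 z & crd1 z < (1 - b) * crd2 z :
    rbeta_spec z (A * crd1 z ^+ 2).

Lemma rbetaP z : rbeta_spec z (rbeta b z).
Proof.
have [[z1 z2]|z0] := pselect (crd1 z <= 0 /\ crd2 z <= 0).
  by rewrite rbeta_nonpos//; constructor.
have [zT|] := pselect (Tset b z).
  have [z1 z2] := T_gt0 _ zT z0; rewrite rbeta_T//.
  by move: zT; rewrite TsetE => -[]; constructor.
have := b_gt0; have := b1_gt0 => c0 b0.
rewrite TsetE => /not_andP[] /negP; rewrite -ltNge => h.
  have z1 : 0 < crd1 z.
    by rewrite ltNge; apply/negP => z1; apply: z0; split => //; nra.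
  by rewrite rbeta_below_T//; constructor.
have z2 : 0 < crd2 z.
  by rewrite ltNge; apply/negP => z2; apply: z0; split => //; nra.
by rewrite rbeta_above_T//; constructor.
Qed.

(** First of four open regions that cover the plane without the origin; in each, the border between
    two pieces becomes the kink of one positive part. Here it is the lower border of the wedge. *)
Lemma rbeta_right z : 0 < crd1 z -> (1 - b) * crd2 z < crd1 z ->
  rbeta b z = A * crd2 z ^+ 2 - K * Num.max (crd2 z - (1 - b) * crd1 z) 0 ^+ 2.
Proof.
have := b_gt0; have := b1_gt0 => c0 b0 z1 v0.
case: rbetaP => [||_|]; try by nra.
- move=> _ z2 u0 _; rewrite max_l ?subr_ge0//.
  by rewrite /A /K; field; rewrite !gt_eqF.
- by move=> u0; rewrite max_r ?subr_le0 ?(ltW u0)// expr0n mulr0 subr0.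
Qed.

Lemma rbeta_top z : 0 < crd2 z -> (1 - b) * crd1 z < crd2 z ->
  rbeta b z = A * crd1 z ^+ 2 - K * Num.max (crd1 z - (1 - b) * crd2 z) 0 ^+ 2.
Proof.
have := b_gt0; have := b1_gt0 => c0 b0 z2 u0.
case: rbetaP => [|||_]; try by nra.
- move=> z1 _ _ v0; rewrite max_l ?subr_ge0//.
  by rewrite /A /K; field; rewrite !gt_eqF.
- by move=> v0; rewrite max_r ?subr_le0 ?(ltW v0)// expr0n mulr0 subr0.
Qed.

(** The border here is the negative half of the second axis: crossing it to the right switches off
    the square of the first coordinate. *)
Lemma rbeta_bottom z : crd2 z < 0 ->
  rbeta b z = A * crd2 z ^+ 2 + A * Num.max (- crd1 z) 0 ^+ 2.
Proof.
have := b_gt0; have := b1_gt0 => c0 b0 z2.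
case: rbetaP; try by nra.
- by move=> z1 _; rewrite max_l ?oppr_ge0//; ring.
- by move=> z1 _; rewrite max_r ?oppr_le0 ?ltW// expr0n mulr0 addr0.
Qed.

Lemma rbeta_left z : crd1 z < 0 ->
  rbeta b z = A * crd1 z ^+ 2 + A * Num.max (- crd2 z) 0 ^+ 2.
Proof.
have := b_gt0; have := b1_gt0 => c0 b0 z1.
case: rbetaP; try by nra.
- by move=> _ z2; rewrite max_l ?oppr_ge0//; ring.
- by move=> z2 _; rewrite max_r ?oppr_le0 ?ltW// expr0n mulr0 addr0.
Qed.

(** Outside the wedge this rests on [1/2 <= A]. Inside it, the piece is symmetric in the
    coordinates, so [key] treats a smaller coordinate [s] and a larger [t]. *)
Lemma half_min_sqr_le_rbeta z :
  Num.min (crd1 z) (crd2 z) ^+ 2 / 2 <= rbeta b z.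
Proof.
have := b_gt0; have := b1_gt0 => c0 b0.
have A2 : 2^-1 <= A by rewrite /A invfM ler_peMr// invf_ge1//; lra.
have minA t : t ^+ 2 / 2 <= A * t ^+ 2.
  by rewrite mulrC ler_wpM2r// sqr_ge0.
have key s t : 0 < s -> s <= t -> (1 - b) * t <= s ->
    s ^+ 2 / 2 <= (2 * b * (2 - b))^-1 * (2 * s * t - (1 - b) * (s ^+ 2 + t ^+ 2)).
  move=> s0 st ts; rewrite mulrC ler_pdivlMl ?mulr_gt0//.
  have -> : 2 * b * (2 - b) * (2^-1 * s ^+ 2) = b * (2 - b) * s ^+ 2 by field.
  (* The difference is written as a sum of products of quantities that are nonnegative for
     [0 < s <= t] inside the wedge. *)
  rewrite -subr_ge0 (_ : _ - _ = b ^+ 2 * s ^+ 2 + (t - s) * (b * s)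
    + (t - s) * (s - (1 - b) * t)); last by ring.
  by rewrite !addr_ge0// mulr_ge0 ?subr_ge0 ?sqr_ge0// mulr_ge0 ?ltW.
case: rbetaP.
- move=> z1 z2; apply: le_trans (minA _) _; rewrite ler_wpM2l ?(ltW A_gt0)//.
  have [_|_] := leP (crd1 z) (crd2 z); [rewrite lerDl|rewrite lerDr]; exact: sqr_ge0.
- move=> z1 z2 u0 v0; have [z12|/ltW z21] := leP (crd1 z) (crd2 z); first exact: key.
  have := key _ _ z2 z21 u0.
  by rewrite [crd2 z ^+ 2 + _]addrC (mulrAC 2 (crd2 z)).
- by move=> z1 z2; rewrite min_r; [exact: minA|nra].
- by move=> z1 z2; rewrite min_l; [exact: minA|nra].
Qed.

Lemma rbeta_ge0 z : 0 <= rbeta b z.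
Proof. by apply: le_trans (half_min_sqr_le_rbeta z); rewrite divr_ge0 ?sqr_ge0. Qed.

(** This settles differentiability at the origin, where all pieces meet. In the wedge, the piece is
    [A * z2^2] minus a nonnegative multiple of a square. *)
Lemma rbeta_le z : rbeta b z <= A * (crd1 z ^+ 2 + crd2 z ^+ 2).
Proof.
have := A_gt0 => A0.
case: rbetaP => // [z1 z2 u0 v0|_ _|_ _]; last 2 first.
- by rewrite ler_wpM2l ?(ltW A_gt0)// lerDr sqr_ge0.
- by rewrite ler_wpM2l ?(ltW A_gt0)// lerDl sqr_ge0.
rewrite [leLHS](_ : _ = A * crd2 z ^+ 2 - K * (crd2 z - (1 - b) * crd1 z) ^+ 2).
  apply: (@le_trans _ _ (A * crd2 z ^+ 2)).
    by rewrite gerBl mulr_ge0 ?sqr_ge0// ltW.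
  by rewrite ler_wpM2l ?(ltW A_gt0)// lerDr sqr_ge0.
by rewrite /A /K; field; rewrite !gt_eqF.
Qed.

(** * The gradient of [rbeta], region by region *)

Lemma Rbeta_right z : 0 < crd1 z -> (1 - b) * crd2 z < crd1 z ->
  let m := Num.max (crd2 z - (1 - b) * crd1 z) 0 in
  has_grad (rbeta b) z (2 * K * (1 - b) * m) (2 * A * crd2 z - 2 * K * m).
Proof.
move=> z1 z2 m.
rewrite /has_grad.
have [|dr -> ->] := @has_grad_sqr_max0 (rbeta b) z 0 A (- K) (- (1 - b)) 1.
  have := @near_crd_gt0 1 0 z; rewrite mul1r mul0r addr0 => /(_ z1).
  have := @near_crd_gt0 1 (- (1 - b)) z; rewrite mul1r mulNr subr_gt0 => /(_ z2).
  apply: filterS2 => w; rewrite !mul1r mul0r addr0 mulNr subr_gt0 => w2 w1.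
  by rewrite rbeta_right// mul0r add0r mulNr mulNr [- (_ * crd1 w) + _]addrC.
by rewrite mul1r mulNr [- _ + _]addrC -/m; split => //; ring.
Qed.

Lemma Rbeta_top z : 0 < crd2 z -> (1 - b) * crd1 z < crd2 z ->
  let m := Num.max (crd1 z - (1 - b) * crd2 z) 0 in
  has_grad (rbeta b) z (2 * A * crd1 z - 2 * K * m) (2 * K * (1 - b) * m).
Proof.
move=> z1 z2 m.
rewrite /has_grad.
have [|dr -> ->] := @has_grad_sqr_max0 (rbeta b) z A 0 (- K) 1 (- (1 - b)).
  have := @near_crd_gt0 0 1 z; rewrite mul1r mul0r add0r => /(_ z1).
  have := @near_crd_gt0 (- (1 - b)) 1 z.
  rewrite addrC mul1r mulNr subr_gt0 => /(_ z2).
  apply: filterS2 => w; rewrite addrC !mul1r mul0r add0r mulNr subr_gt0 => w2 w1.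
  by rewrite rbeta_top// mul0r addr0 !mulNr.
by rewrite mul1r mulNr -/m; split => //; ring.
Qed.

Lemma Rbeta_bottom z : crd2 z < 0 ->
  has_grad (rbeta b) z (2 * A * Num.min (crd1 z) 0) (2 * A * crd2 z).
Proof.
move=> z2.
rewrite /has_grad.
have [|dr -> ->] := @has_grad_sqr_max0 (rbeta b) z 0 A A (- 1) 0.
  have := @near_crd_gt0 0 (- 1) z.
  rewrite mul0r add0r mulN1r oppr_gt0 => /(_ z2).
  apply: filterS => w; rewrite mul0r add0r mulN1r oppr_gt0 => w2.
  by rewrite rbeta_bottom// !mul0r add0r addr0 mulN1r.
by rewrite mul0r addr0 mulN1r -[X in Num.max _ X]oppr0 -oppr_min; split => //; ring.
Qed.

Lemma Rbeta_left z : crd1 z < 0 ->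
  has_grad (rbeta b) z (2 * A * crd1 z) (2 * A * Num.min (crd2 z) 0).
Proof.
move=> z1.
rewrite /has_grad.
have [|dr -> ->] := @has_grad_sqr_max0 (rbeta b) z A 0 A 0 (- 1).
  have := @near_crd_gt0 (- 1) 0 z.
  rewrite mul0r addr0 mulN1r oppr_gt0 => /(_ z1).
  apply: filterS => w; rewrite mul0r addr0 mulN1r oppr_gt0 => w1.
  by rewrite rbeta_left// !mul0r add0r addr0 mulN1r.
by rewrite mul0r add0r mulN1r -[X in Num.max _ X]oppr0 -oppr_min; split => //; ring.
Qed.

Lemma Rbeta_zero : has_grad (rbeta b) 0 0 0.
Proof.
have c1 : crd1 (0 : 'rV[R]_2) = 0 by rewrite /crd1 mxE.
have c2 : crd2 (0 : 'rV[R]_2) = 0 by rewrite /crd2 mxE.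
have r0 : rbeta b 0 = 0.
  by rewrite rbeta_nonpos ?c1 ?c2// expr0n addr0 mulr0.
have d : is_diff (0 : 'rV[R]_2) (rbeta b) (dot 0).
  (* The factor 2 counts the two coordinates, each bounded by the max norm. *)
  apply: (@is_diff_quadratic R 2 (rbeta b) 0 0 (A * 2)).
  apply: (@filterE _ (nbhs (0 : 'rV[R]_2))) => w.
  rewrite r0 !subr0 [dot _ _](_ : _ = 0) ?subr0; last first.
    by rewrite dot2E c1 c2 !mul0r addr0.
  rewrite ger0_norm ?rbeta_ge0// (le_trans (rbeta_le w))//.
  rewrite -mulrA ler_wpM2l ?(ltW A_gt0)//.
  rewrite mulr2n mulrDl !mul1r; apply: lerD;
    by rewrite -[leLHS]real_normK ?num_real// lerXn2r ?nnegrE ?normr_coord.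
have gE := is_diff_grad _ _ _ _ d.
by split; [case: d|rewrite gE|rewrite gE].
Qed.

Variant plane_spec z : Prop :=
| PlaneZero of z = 0
| PlaneRight of 0 < crd1 z & (1 - b) * crd2 z < crd1 z
| PlaneTop of 0 < crd2 z & (1 - b) * crd1 z < crd2 z
| PlaneBottom of crd2 z < 0
| PlaneLeft of crd1 z < 0.

(** If no coordinate is negative and [z] is not the origin, a largest coordinate is positive and
    strictly exceeds [1 - b] times the other. *)
Lemma planeP z : plane_spec z.
Proof.
have := b_gt0; have := b1_gt0 => c0 b0.
have [z1|z1] := ltP (crd1 z) 0; first exact: PlaneLeft.
have [z2|z2] := ltP (crd2 z) 0; first exact: PlaneBottom.
have [z0|z12] := eqVneq (crd1 z) (crd2 z).
  have [z10|z10] := eqVneq (crd1 z) 0; last first.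
    have : 0 < crd1 z by rewrite lt_neqAle eq_sym z10.
    by move=> ?; apply: PlaneRight; nra.
  by apply: PlaneZero; apply: crd_inj; rewrite -?z0 z10 /crd1 /crd2 mxE.
move: z12; rewrite neq_lt => /orP[] h; first by apply: PlaneTop; nra.
by apply: PlaneRight; nra.
Qed.

Lemma differentiable_rbeta z : differentiable (rbeta b) z.
Proof.
case: (planeP z) => [->|h1 h2|h1 h2|h|h].
- by case: Rbeta_zero.
- by case: (Rbeta_right _ h1 h2).
- by case: (Rbeta_top _ h1 h2).
- by case: (Rbeta_bottom _ h).
- by case: (Rbeta_left _ h).
Qed.

End Rbeta.
End Plane.

(** * Sign pattern of [Rbeta] and membership in the cone *)

Section Cone.
Context {R : realType}.
Implicit Types (z w y : 'rV[R]_2).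
Variable b : R.
Hypothesis b01 : 0 < b < 1.

Let b_gt0 : 0 < b. Proof. by case/andP: b01. Qed.
Let b1_gt0 : 0 < 1 - b. Proof. by rewrite subr_gt0; case/andP: b01. Qed.
Let b2_gt0 : 0 < 2 - b. Proof. by move: b1_gt0; lra. Qed.
Let A_gt0 : 0 < (2 * (1 - b))^-1. Proof. by rewrite invr_gt0 mulr_gt0. Qed.
Let K_gt0 : 0 < (2 * b * (2 - b) * (1 - b))^-1.
Proof. by rewrite invr_gt0 !mulr_gt0. Qed.

(** On the wedge, each partial derivative is [2 * K * (1 - b)] times one of the two linear forms
    that are nonnegative there. *)
Lemma Rbeta_T_ge0 z : Tset b z -> 0 <= crd1 (Rbeta b z) /\ 0 <= crd2 (Rbeta b z).
Proof.
have c0 := b1_gt0; have b0 := b_gt0.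
have K0 s t : 0 <= t - s -> 0 <= 2 * (2 * b * (2 - b) * (1 - b))^-1 * (1 - b) * (t - s).
  by move=> ?; rewrite !mulr_ge0// ltW.
rewrite (TsetE b b01) => -[u0 v0]; rewrite /Rbeta.
case: (planeP b b01 z) => [->|z1 v1|z2 u1|z2|z1]; last 2 first.
(* A negative coordinate would make the other negative too, and chaining the two wedge inequalities
   would contradict [(1 - b)^2 < 1]. *)
- have z1 : crd1 z < 0 by nra.
  by exfalso; nra.
- have z2 : crd2 z < 0 by nra.
  by exfalso; nra.
- by have [_ -> ->] := Rbeta_zero b b01.
- have [_ -> ->] := Rbeta_right b b01 z z1 v1.
  rewrite max_l; last by rewrite subr_ge0.
  split; first by rewrite K0 ?subr_ge0.
  rewrite [leRHS](_ : _ = 2 * (2 * b * (2 - b) * (1 - b))^-1 * (1 - b)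
    * (crd1 z - (1 - b) * crd2 z)); last by field; rewrite !gt_eqF.
  by rewrite K0 ?subr_ge0.
- have [_ -> ->] := Rbeta_top b b01 z z2 u1.
  rewrite max_l; last by rewrite subr_ge0.
  split; last by rewrite K0 ?subr_ge0.
  rewrite [leRHS](_ : _ = 2 * (2 * b * (2 - b) * (1 - b))^-1 * (1 - b)
    * (crd2 z - (1 - b) * crd1 z)); last by field; rewrite !gt_eqF.
  by rewrite K0 ?subr_ge0.
Qed.

Lemma Rbeta_nonpos z : crd1 z <= 0 -> crd2 z <= 0 ->
  crd1 (Rbeta b z) <= 0 /\ crd2 (Rbeta b z) <= 0.
Proof.
have c0 := b1_gt0; have b0 := b_gt0; have A0 := A_gt0; rewrite /Rbeta => z1 z2.
case: (planeP b b01 z) => [->|h v1|h u1|h|h].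
- by have [_ -> ->] := Rbeta_zero b b01.
- by rewrite ltNge z1 in h.
- by rewrite ltNge z2 in h.
- have [_ -> ->] := Rbeta_bottom b b01 z h.
  by split; rewrite mulr_ge0_le0 ?mulr_ge0 ?(ltW A0)// ge_min z1.
- have [_ -> ->] := Rbeta_left b b01 z h.
  by split; rewrite mulr_ge0_le0 ?mulr_ge0 ?(ltW A0)// ge_min z2.
Qed.

(** The positive part vanishes up to and including the border. Border points matter: they are
    outside the interior of [Tset b], so [PiDC] projects them onto an axis. *)
Lemma crd1_Rbeta_below_T z : 0 < crd1 z -> crd2 z <= (1 - b) * crd1 z ->
  crd1 (Rbeta b z) = 0.
Proof.
move=> z1 u0; have c0 := b1_gt0; have b0 := b_gt0.
have z12 : crd2 z < crd1 z by nra.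
have [|_ -> _] := Rbeta_right b b01 z z1; first by nra.
by rewrite max_r ?mulr0// subr_le0.
Qed.

Lemma crd2_Rbeta_above_T z : 0 < crd2 z -> crd1 z <= (1 - b) * crd2 z ->
  crd2 (Rbeta b z) = 0.
Proof.
move=> z2 v0; have c0 := b1_gt0; have b0 := b_gt0.
have z12 : crd1 z < crd2 z by nra.
have [|_ _ ->] := Rbeta_top b b01 z z2; first by nra.
by rewrite max_r ?mulr0// subr_le0.
Qed.

(** By contraposition, a point outside the interior satisfies one of the reversed inequalities,
    which closes the case analysis of [NDC_Rbeta]. *)
Lemma interior_T z : (1 - b) * crd1 z < crd2 z -> (1 - b) * crd2 z < crd1 z ->
  interior (Tset b) z.
Proof.
move=> u0 v0.
have := near_crd_gt0 (- (1 - b)) 1 z; rewrite addrC mul1r mulNr subr_gt0 => /(_ u0).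
have := near_crd_gt0 1 (- (1 - b)) z; rewrite mul1r mulNr subr_gt0 => /(_ v0).
apply: filterS2 => w; rewrite mul1r mulNr subr_gt0 => v1.
by rewrite addrC mul1r mulNr subr_gt0 => u1; rewrite (TsetE b b01) !ltW.
Qed.

Lemma ler_norm2 (u v : 'rV[R]_2) : (norm2 u <= norm2 v) =
  (crd1 u ^+ 2 + crd2 u ^+ 2 <= crd1 v ^+ 2 + crd2 v ^+ 2).
Proof. by rewrite -!norm2_sqr2 ler_pXn2r// nnegrE sqrtr_ge0. Qed.

Lemma crd1B z w : crd1 (z - w) = crd1 z - crd1 w.
Proof. by rewrite /crd1 !mxE. Qed.

Lemma crd2B z w : crd2 (z - w) = crd2 z - crd2 w.
Proof. by rewrite /crd2 !mxE. Qed.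

(** * Euclidean projections onto [Dset] *)

Lemma projection_nonpos z w : crd1 z <= 0 -> crd2 z <= 0 ->
  is_projection Dset z w <-> w = 0.
Proof.
move=> z1 z2.
have c1 : crd1 (0 : 'rV[R]_2) = 0 by rewrite /crd1 mxE.
have c2 : crd2 (0 : 'rV[R]_2) = 0 by rewrite /crd2 mxE.
have D0 : Dset (0 : 'rV[R]_2) by split; rewrite ?c1 ?c2 ?mul0r.
split => [[[w1 w2 _] /(_ _ D0)]|->].
  rewrite ler_norm2 subr0 crd1B crd2B => h.
  by apply: crd_inj; rewrite ?c1 ?c2; nra.
split => // w' [w1 w2 _]; rewrite ler_norm2 subr0 crd1B crd2B; nra.
Qed.

(** Dropping the second coordinate gives a point of [Dset] at distance [|z2|], and [far] shows that
    the vertical half-axis is strictly farther. Positivity of the first coordinate then selects the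
    branch of [NDC]. *)
Lemma projection_below_T z : 0 < crd1 z -> crd2 z < crd1 z ->
  (exists w, is_projection Dset z w) /\
  (forall w, is_projection Dset z w -> 0 < crd1 w).
Proof.
move=> z1 z12.
have Dp : Dset (vec2 (crd1 z) 0).
  by split; rewrite ?crd1_vec2 ?crd2_vec2 ?mulr0// ltW.
have far w : crd1 w = 0 -> 0 <= crd2 w ->
    crd2 z ^+ 2 < (crd1 z - crd1 w) ^+ 2 + (crd2 z - crd2 w) ^+ 2.
  move=> -> w2; rewrite subr0; have [z2|z2] := leP (crd2 z) 0; first by nra.
  have z2z1 : crd2 z ^+ 2 < crd1 z ^+ 2 by nra.
  by rewrite ltr_wpDr ?sqr_ge0.
split=> [|w [[w1 w2 w12] /(_ _ Dp)]].
  exists (vec2 (crd1 z) 0); split=> // w [w1 w2 w12].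
  rewrite ler_norm2 !crd1B !crd2B crd1_vec2 crd2_vec2 subrr expr0n add0r subr0.
  have [w10|w10] := eqVneq (crd1 w) 0; first exact: ltW (far _ w10 w2).
  move/eqP: w12; rewrite mulf_eq0 (negbTE w10) /= => /eqP ->.
  by rewrite subr0 lerDr sqr_ge0.
rewrite ler_norm2 !crd1B !crd2B crd1_vec2 crd2_vec2 subrr expr0n add0r subr0.
move=> h; rewrite lt_neqAle w1 andbT eq_sym; apply/eqP => w10.
by have := lt_le_trans (far _ w10 w2) h; rewrite ltxx.
Qed.

Lemma projection_above_T z : 0 < crd2 z -> crd1 z < crd2 z ->
  (exists w, is_projection Dset z w) /\
  (forall w, is_projection Dset z w -> 0 < crd2 w).
Proof.
move=> z2 z12.
have Dp : Dset (vec2 0 (crd2 z)).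
  by split; rewrite ?crd1_vec2 ?crd2_vec2 ?mul0r// ltW.
have far w : crd2 w = 0 -> 0 <= crd1 w ->
    crd1 z ^+ 2 < (crd1 z - crd1 w) ^+ 2 + (crd2 z - crd2 w) ^+ 2.
  move=> -> w1; rewrite subr0; have [z1|z1] := leP (crd1 z) 0; first by nra.
  have z1z2 : crd1 z ^+ 2 < crd2 z ^+ 2 by nra.
  by rewrite ltr_wpDl ?sqr_ge0.
split=> [|w [[w1 w2 w12] /(_ _ Dp)]].
  exists (vec2 0 (crd2 z)); split=> // w [w1 w2 w12].
  rewrite ler_norm2 !crd1B !crd2B crd1_vec2 crd2_vec2 subrr expr0n addr0 subr0.
  have [w20|w20] := eqVneq (crd2 w) 0; first exact: ltW (far _ w20 w1).
  move/eqP: w12; rewrite mulf_eq0 (negbTE w20) orbF => /eqP ->.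
  by rewrite subr0 lerDl sqr_ge0.
rewrite ler_norm2 !crd1B !crd2B crd1_vec2 crd2_vec2 subrr expr0n addr0 subr0.
move=> h; rewrite lt_neqAle w2 andbT eq_sym; apply/eqP => w20.
by have := lt_le_trans (far _ w20 w1) h; rewrite ltxx.
Qed.

(** In the interior of the wedge and in the nonpositive quadrant [PiDC] is the origin, and both
    coordinates of [Rbeta] share a sign. Elsewhere [PiDC] lies on a positive half-axis, and the
    coordinate of [Rbeta] along that axis vanishes. *)
Lemma NDC_Rbeta (c : R) z : 0 <= c -> NDC (PiDC b z) (c *: Rbeta b z).
Proof.
move=> c_ge0; have c0 := b1_gt0; have b0 := b_gt0.
have e1 y : crd1 (c *: y) = c * crd1 y by rewrite /crd1 mxE.
have e2 y : crd2 (c *: y) = c * crd2 y by rewrite /crd2 mxE.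
have D0 : Dset (0 : 'rV[R]_2) by split; rewrite /crd1 /crd2 !mxE ?mul0r.
rewrite /PiDC; case: asboolP => [/interior_subset /Rbeta_T_ge0[r1 r2]|nT].
  by split=> //; apply: Or33; split=> //; apply: Or33; rewrite e1 e2 !mulr_ge0.
have [[z1 z2]|z0] := pselect (crd1 z <= 0 /\ crd2 z <= 0).
  have -> : xget 0 [set w | is_projection Dset z w] = 0.
    apply/(projection_nonpos z _ z1 z2).
    apply: (@xgetPex _ _ [set w | is_projection Dset z w]).
    by exists 0; apply/(projection_nonpos z _ z1 z2).
  have [r1 r2] := Rbeta_nonpos _ z1 z2.
  by split=> //; apply: Or33; split=> //; apply: Or31; rewrite e1 e2 !mulr_ge0_le0.
have [u0|u0] := leP (crd2 z) ((1 - b) * crd1 z).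
  have z1 : 0 < crd1 z.
    by rewrite ltNge; apply/negP => z1; apply: z0; split => //; nra.
  have z12 : crd2 z < crd1 z by nra.
  have [ex pos] := projection_below_T _ z1 z12.
  (* Existence of a projection ensures that [xget] returns a genuine one rather than its default. *)
  have pr : is_projection Dset z (xget 0 [set w | is_projection Dset z w]).
    exact: (@xgetPex _ _ [set w | is_projection Dset z w]).
  split; first by case: pr.
  by apply: Or31; rewrite e1 crd1_Rbeta_below_T// mulr0; split=> //; exact: pos.
have [v0|v0] := leP (crd1 z) ((1 - b) * crd2 z); last first.
  by case: nT; exact: interior_T.
have z2 : 0 < crd2 z.
  by rewrite ltNge; apply/negP => z2; apply: z0; split => //; nra.
have z12 : crd1 z < crd2 z by nra.
have [ex pos] := projection_above_T _ z2 z12.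
have pr : is_projection Dset z (xget 0 [set w | is_projection Dset z w]).
  exact: (@xgetPex _ _ [set w | is_projection Dset z w]).
split; first by case: pr.
by apply: Or32; rewrite e2 crd2_Rbeta_above_T// mulr0; split=> //; exact: pos.
Qed.

End Cone.

(** * Chain rule for the merit function *)

Section Gradients.
Context {R : realType}.

Lemma gradDZsum n p (f : 'rV[R]_n -> R) (c : R) (g : 'I_p -> 'rV[R]_n -> R) x :
  differentiable f x -> (forall i, differentiable (g i) x) ->
  grad (fun u => f u + c * \sum_i g i u) x = grad f x + c *: \sum_i grad (g i) x.
Proof.
move=> df dg; apply/rowP => j; rewrite !mxE summxE.
have dv (h : 'rV[R]_n -> R) : differentiable h x -> derivable h x (delta_mx 0 j).
  exact: diff_derivable.
have dS : derivable (\sum_i g i) x (delta_mx 0 j).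
  by apply: derivable_sum => i; exact: dv.
rewrite (_ : (fun u => _) = f + c *: \sum_i g i); last first.
  by apply/funext => u; rewrite !fctE fct_sumE.
rewrite deriveD; [|exact: dv|exact: derivableZ].
rewrite deriveZ// derive_sum; last by move=> i; exact: dv.
by congr (_ + _ *: _); apply: eq_bigr => i _; rewrite mxE.
Qed.

Variables (n p : nat) (G H : 'rV[R]_n -> 'rV[R]_p).

Lemma crd1_Fpair i x : crd1 (Fpair G H i x) = G x 0 i.
Proof. by rewrite /crd1 mxE. Qed.

Lemma crd2_Fpair i x : crd2 (Fpair G H i x) = H x 0 i.
Proof. by rewrite /crd2 mxE. Qed.

Lemma mul_JF i x (y : 'rV[R]_2) : y *m JF G H i x =
  crd1 y *: grad (fun u => G u 0 i) x + crd2 y *: grad (fun u => H u 0 i) x.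
Proof.
have jE : (ord_max : 'I_2) = rshift 1 (0 : 'I_1) by exact: val_inj.
have iE : (ord0 : 'I_2) = lshift 1 (0 : 'I_1) by exact: val_inj.
have J0 j : JF G H i x ord0 j = grad (fun u => G u 0 i) x 0 j.
  by rewrite iE; exact: col_mxEu.
have J1 j : JF G H i x ord_max j = grad (fun u => H u 0 i) x 0 j.
  by rewrite jE; exact: col_mxEd.
apply/rowP => j; rewrite [LHS]mxE sum_ord2 J0 J1 [RHS]mxE.
by congr (_ + _); rewrite [RHS]mxE.
Qed.

Lemma is_diff_Fpair i x :
  differentiable (fun u => G u 0 i) x -> differentiable (fun u => H u 0 i) x ->
  is_diff x (Fpair G H i) (fun h => vec2 (dot (grad (fun u => G u 0 i) x) h)
                                         (dot (grad (fun u => H u 0 i) x) h)).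
Proof.
move=> dG dH.
(* Written as scalar functions times fixed vectors, the pair inherits its differential from its
   components. *)
have FE : Fpair G H i = (fun u => G u 0 i *: vec2 1 0) + (fun u => H u 0 i *: vec2 0 1).
  apply/funext => u; rewrite !fctE; apply/rowP => k; rewrite !mxE.
  by case: ifP => _; rewrite ?mulr1 ?mulr0 ?addr0 ?add0r.
have dZ (g : 'rV[R]_n -> R) (v : 'rV[R]_2) : differentiable g x ->
    is_diff x (fun u => g u *: v) (fun h => dot (grad g x) h *: v).
  move=> dg; split; first exact: differentiableZl.
  by rewrite (diffZl v dg); apply/funext => h; rewrite (diff_grad _ _ _ dg).
rewrite FE; apply: (is_diff_eq (is_diffD (dZ _ _ dG) (dZ _ _ dH))).
apply/funext => u; rewrite !fctE; apply/rowP => k; rewrite !mxE.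
by case: ifP => _; rewrite ?mulr1 ?mulr0 ?addr0 ?add0r.
Qed.

Lemma is_diff_comp_Fpair (r : 'rV[R]_2 -> R) i x :
  differentiable (fun u => G u 0 i) x -> differentiable (fun u => H u 0 i) x ->
  differentiable r (Fpair G H i x) ->
  is_diff x (r \o Fpair G H i) (dot (grad r (Fpair G H i x) *m JF G H i x)).
Proof.
move=> dG dH dr; have [dF FE] := is_diff_Fpair i x dG dH.
split; first exact: differentiable_comp.
rewrite diff_comp// FE diff_grad//; apply/funext => h /=.
rewrite dot2E crd1_vec2 crd2_vec2 mul_JF /dot !mulr_sumr -big_split/=.
by apply: eq_bigr => j _; rewrite !mxE mulrDl !mulrA.
Qed.

Lemma grad_slb f (lambda b : R) x : 0 < b < 1 -> differentiable f x ->
  (forall i, differentiable (fun u => G u 0 i) x) ->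
  (forall i, differentiable (fun u => H u 0 i) x) ->
  grad (slb f G H lambda b) x = grad f x +
    \sum_(i < p) (lambda^-1 *: Rbeta b (Fpair G H i x)) *m JF G H i x.
Proof.
move=> b01 df dG dH.
have d i := is_diff_comp_Fpair (rbeta b) i x (dG i) (dH i)
  (differentiable_rbeta b b01 _).
rewrite [LHS]gradDZsum; [|exact: df|by move=> i; case: (d i)].
rewrite scaler_sumr; congr (_ + _); apply: eq_bigr => i _.
by rewrite -scalemxAl (is_diff_grad _ _ _ _ (d i)).
Qed.

(** With this bound the threshold [eps^2 / 2] of the stopping test becomes a residual of norm at
    most [eps]. *)
Lemma norm2_min_vec_le (b : R) x : 0 < b < 1 ->
  norm2 (min_vec (G x) (H x)) ^+ 2 <= 2 * penalty G H b x.
Proof.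
move=> b01; rewrite norm2_sqr /penalty mulr_sumr; apply: ler_sum => i _.
rewrite mxE -ler_pdivrMl// mulrC.
have := half_min_sqr_le_rbeta b b01 (Fpair G H i x).
by rewrite crd1_Fpair crd2_Fpair.
Qed.

End Gradients.

(** * Iteration count *)

Section Homotopy.
Context {R : realType}.
Variables (n p : nat) (f : 'rV[R]_n -> R) (G H : 'rV[R]_n -> 'rV[R]_p).
Variables (C : set 'rV[R]_n) (eps beta rho fmin : R).
Variables (lam : nat -> R) (x xs : nat -> 'rV[R]_n).
Hypothesis f_bounded : forall u, C u -> fmin <= f u.
Hypothesis eps_gt0 : 0 < eps.
Hypothesis rho01 : 0 < rho < 1.
Hypothesis run : homotopy_run f G H C eps beta rho lam x xs.

Let stop mu := stop_test G H eps beta (x mu).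

Lemma lamE nu : lam nu = rho ^+ nu * lam 0%N.
Proof.
case: run => _ lamS _ _; elim: nu => [|nu IH]; first by rewrite mul1r.
by rewrite lamS IH mulrA exprS.
Qed.

Lemma lam_gt0 nu : 0 < lam nu.
Proof.
case: run => l0 _ _ _; rewrite lamE mulr_gt0// exprn_gt0//.
by case/andP: rho01.
Qed.

Lemma not_stopped_lt nu : (0 < nu)%N ->
  (forall mu, (1 <= mu <= nu)%N -> ~ stop mu) ->
  1 < rho ^+ nu * (4 * lam 0%N * (f (x 0%N) - fmin) / eps ^+ 2).
Proof.
case: nu => // nu _ ns; have L := lam_gt0 nu.+1.
have /negP := ns nu.+1 (leqnn _).
rewrite -ltNge => pnu; case: run => _ _ [C0 p0] /(_ nu)[].
  by move=> mu /andP[m1 m2]; apply: ns; rewrite m1 leqW.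
move=> _ Cx; rewrite le_min => /andP[_ sx] _.
have e2 : 0 < eps ^+ 2 by rewrite exprn_gt0.
rewrite (_ : _ * _ = 4 * (lam nu.+1 * (f (x 0%N) - fmin)) / eps ^+ 2); last first.
  by rewrite [lam nu.+1]lamE; field; rewrite gt_eqF.
rewrite ltr_pdivlMr// mul1r -ltr_pdivrMl// [ltLHS]mulrC.
rewrite -ltr_pdivrMl// ltrBrDl.
have fx := f_bounded _ Cx.
(* The failed test and the near-feasible start leave a penalty gap above [eps^2 / 2 - eps^2 / 4];
   the merit comparison with [x 0] converts it into a gap in [f]. *)
have : (lam nu.+1)^-1 * (eps ^+ 2 / 4) <
    (lam nu.+1)^-1 * (penalty G H beta (x nu.+1) - penalty G H beta (x 0%N)).
  rewrite ltr_pM2l ?invr_gt0//; lra.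
by rewrite mulrBr; move: sx; rewrite /slb; lra.
Qed.

(** Since [rho^nu <= 1], the preceding bound forces [1 < a]; logarithms can then be taken. *)
Lemma iteration_lt nu (a := 4 * lam 0%N * (f (x 0%N) - fmin) / eps ^+ 2) :
  (0 < nu)%N -> (forall mu, (1 <= mu <= nu)%N -> ~ stop mu) ->
  1 < a /\ nu%:R < ln a / ln rho^-1.
Proof.
move=> nu0 ns; have := not_stopped_lt nu nu0 ns; rewrite -/a => h.
have /andP[r0 r1] := rho01.
have rn : 0 < rho ^+ nu by rewrite exprn_gt0.
have a1 : 1 < a.
  rewrite ltNge; apply/negP => a1.
  have : rho ^+ nu * a <= 1.
    have [a0|a0] := leP a 0; first by rewrite (@le_trans _ _ 0)// mulr_ge0_le0// ltW.
    by rewrite mulr_ile1 ?exprn_ile1// ltW.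
  by rewrite leNgt h.
split=> //; rewrite ltr_pdivlMr; last by rewrite ln_gt0// invf_gt1.
rewrite mulr_natl -lnXn ?invr_gt0// ltr_ln ?posrE ?exprn_gt0 ?invr_gt0//.
  by rewrite exprVn -[ltLHS]mul1r ltr_pdivrMr// mulrC.
exact: lt_trans a1.
Qed.

Lemma run_stops : exists nubar, stops_at G H eps beta x nubar.
Proof.
pose P nu := (0 < nu)%N && `[< stop nu >].
have exP : exists nu, P nu.
  apply: contrapT => /forallNP noP.
  have ns nu : (0 < nu)%N -> ~ stop nu.
    by move=> nu0 s; apply: (noP nu); rewrite /P nu0; exact/asboolP.
  (* If no test ever succeeded, [iteration_lt] would put every positive index below [t], in
     particular the successor of its integer part. *)
  pose t := ln (4 * lam 0%N * (f (x 0%N) - fmin) / eps ^+ 2) / ln rho^-1.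
    have [||_] := iteration_lt (Num.truncn t).+1 => //.
    by move=> mu /andP[m1 _]; exact: ns.
  by rewrite ltNge ltW// truncnS_gt.
have [nu /andP[nu0 /asboolP s] nu_min] := ex_minnP exP.
exists nu; split=> // mu /andP[mu0 munu] smu.
have /nu_min : P mu by rewrite /P mu0; exact/asboolP.
by rewrite leqNgt munu.
Qed.

End Homotopy.

(** For [a <= 1] the logarithmic bound would read [nubar < 1] or less, also for [a <= 0], where [ln]
    takes its default value 0. The count is then stated as [nubar = 1]. *)
Theorem theorem5p7 (R : realType) (n p : nat)
    (f : 'rV[R]_n -> R) (G H : 'rV[R]_n -> 'rV[R]_p) (C : set 'rV[R]_n)
    (eps beta rho fmin : R)
    (lam : nat -> R) (x xs : nat -> 'rV[R]_n)
    (f_smooth : smooth f)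
    (G_smooth : forall i, smooth (fun u => G u 0 i))
    (H_smooth : forall i, smooth (fun u => H u 0 i))
    (C_nonempty : C !=set0) (C_closed : closed C) (C_convex : convex_set C)
    (solvable : solutions f G H C !=set0)
    (level_compact : forall a : R, compact (C `&` [set u | f u <= a]))
    (f_bounded : forall u, C u -> fmin <= f u)
    (eps_gt0 : 0 < eps) (beta01 : 0 < beta < 1) (rho01 : 0 < rho < 1)
    (run : homotopy_run f G H C eps beta rho lam x xs) :
  exists nubar : nat,
    [/\ stops_at G H eps beta x nubar,
        let a := 4 * lam 0%N * (f (x 0%N) - fmin) / eps ^+ 2 in
          (1 < a -> nubar%:R < 1 + ln a / ln rho^-1) /\
          (a <= 1 -> nubar = 1%N)
      & let xbar := x nubar in
        let z i := PiDC beta (Fpair G H i xbar) in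
        let y i := (lam nubar)^-1 *: Rbeta beta (Fpair G H i xbar) in
        [/\ (dist (- grad f xbar - \sum_(i < p) y i *m JF G H i xbar)
                  (normal_cone C xbar) <= eps%:E)%E,
            norm2 (min_vec (G xbar) (H xbar)) <= eps
          & forall i : 'I_p, NDC (z i) (y i)]].
Proof.
have it nu := iteration_lt _ _ f G H C eps beta rho fmin lam x xs f_bounded eps_gt0
  rho01 run nu.
have lam0 nu := lam_gt0 _ _ f G H C eps beta rho lam x xs rho01 run nu.
have [nubar st] := run_stops _ _ f G H C eps beta rho fmin lam x xs f_bounded
  eps_gt0 rho01 run.
exists nubar; case: (st) => nu0 stop_nu nstop; split=> //.
  (* For [nubar = 1] both clauses are immediate. Otherwise [iteration_lt] applies to the preceding
     index, whose test failed: this is the source of the summand 1, and it rules out [a <= 1]. *)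
  case: nubar nu0 {st stop_nu} nstop => // -[|nu] _ nstop a.
    split=> // a1; rewrite ltrDl divr_gt0// ln_gt0// invf_gt1;
      by case/andP: rho01.
  have [|] := it nu.+1 isT; first exact: nstop.
  rewrite -/a => a1 lnu; split=> [_|]; last by rewrite leNgt a1.
  by rewrite -natr1 addrC ltrD2l.
split=> [||i]; last by apply: NDC_Rbeta => //; rewrite invr_ge0 ltW.
  (* As [nubar] is positive, its iterate is the output of an inner step, which carries the
     stationarity bound. *)
  case: nubar nu0 {st stop_nu} nstop => // nu _ nstop.
  case: run => _ _ _ /(_ nu)[|_ _ _]; first exact: nstop.
  rewrite grad_slb// ?opprD//; first by case: f_smooth.
    by move=> i; case: (G_smooth i).
  by move=> i; case: (H_smooth i).
rewrite -(@ler_pXn2r _ 2) ?nnegrE ?sqrtr_ge0 ?(ltW eps_gt0)//.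
apply: le_trans (norm2_min_vec_le _ _ _ _ _ _ beta01) _.
by move: stop_nu; rewrite /stop_test; lra.
Qed.
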